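(* Let $H$ be a graph and let $k > 1$ be an integer. If every $H$-free graph is perfectly $(k-1)$-divisible, then every $(H \cup K_1)$-free graph is perfectly $k$-divisible.
   Context: All graphs are finite, simple and undirected. $\omega(G)$ denotes the clique number; $G[X]$ is the subgraph induced by $X \subseteq V(G)$. A graph $G$ is $F$-free if it has no induced subgraph isomorphic to $F$. $H \cup K_1$ denotes the disjoint union of $H$ with a single isolated vertex. A graph $G$ is perfect if $\chi(H')=\omega(H')$ for every induced subgraph $H'$ of $G$. A graph $G$ is perfectly $1$-divisible if $G$ is perfect. For an integer $k>1$, a graph $G$ is perfectly $k$-divisible if for every induced subgraph $H'$ of $G$, either $V(H')$ is a stable set or $V(H')$ admits a partition into two sets $X_1, X_2$ such that $\omega(H'[X_1]) < \omega(H')$ and $H'[X_2]$ is perfectly $(k-1)$-divisible. *)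

(* Defs.v *)
From HB Require Import structures.
From mathcomp Require Import all_boot.
Set Implicit Arguments.
Unset Strict Implicit.
Unset Printing Implicit Defensive.

Record sgraph := SGraph {
  vertex :> finType;
  adj : rel vertex;
  adj_sym : symmetric adj;
  adj_irrefl : irreflexive adj
}.

Section Induced.
Variables (G : sgraph) (X : {set G}).

Definition induced_adj : rel {x : G | x \in X} :=
  [rel u v | adj (val u) (val v)].

Lemma induced_adj_sym : symmetric induced_adj.
Proof. by move=> u v; exact: adj_sym. Qed.

Lemma induced_adj_irrefl : irreflexive induced_adj.
Proof. by move=> u; exact: adj_irrefl. Qed.

Definition induced : sgraph := SGraph induced_adj_sym induced_adj_irrefl.
End Induced.

Definition isomorphic (G F : sgraph) : Prop :=
  exists f : G -> F,
    bijective f /\ (forall x y : G, adj (f x) (f y) = adj x y).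

Definition free (F G : sgraph) : Prop :=
  ~ (exists X : {set G}, isomorphic (induced X) F).

Section DisjointUnion.
Variables G F : sgraph.

Definition dunion_adj : rel (G + F)%type := fun u v =>
  match u, v with
  | inl x, inl y => adj x y
  | inr x, inr y => adj x y
  | _, _ => false
  end.

Lemma dunion_adj_sym : symmetric dunion_adj.
Proof. by move=> [x|x] [y|y] //=; rewrite adj_sym. Qed.

Lemma dunion_adj_irrefl : irreflexive dunion_adj.
Proof. by move=> [x|x] /=; rewrite adj_irrefl. Qed.

Definition dunion : sgraph := SGraph dunion_adj_sym dunion_adj_irrefl.
End DisjointUnion.

Section Complete.
Variable n : nat.

Definition complete_adj : rel 'I_n := [rel i j | i != j].

Lemma complete_adj_sym : symmetric complete_adj.
Proof. by move=> i j; rewrite /complete_adj /= eq_sym. Qed.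

Lemma complete_adj_irrefl : irreflexive complete_adj.
Proof. by move=> i; rewrite /complete_adj /= eqxx. Qed.

Definition complete : sgraph := SGraph complete_adj_sym complete_adj_irrefl.
End Complete.

Definition clique (G : sgraph) (A : {set G}) : bool :=
  [forall x in A, forall y in A, (x != y) ==> adj x y].

Definition stable (G : sgraph) (A : {set G}) : bool :=
  [forall x in A, forall y in A, ~~ adj x y].

Definition omega (G : sgraph) : nat := \max_(A : {set G} | clique A) #|A|.

Definition colorable (G : sgraph) (n : nat) : bool :=
  [exists c : {ffun G -> 'I_n},
     forall x : G, forall y : G, adj x y ==> (c x != c y)].

Lemma ex_colorable (G : sgraph) : exists n, colorable G n.
Proof.
exists #|G|; apply/existsP; exists [ffun x => enum_rank x].
apply/forallP => x; apply/forallP => y; apply/implyP => xy.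
rewrite !ffunE; apply: contraTneq xy => /enum_rank_inj ->.
by rewrite adj_irrefl.
Qed.

Definition chi (G : sgraph) : nat := ex_minn (ex_colorable G).

Definition perfect (G : sgraph) : Prop :=
  forall X : {set G}, chi (induced X) = omega (induced X).

(* The notion is only meaningful for k >= 1; the value at 0 is junk and is
   never reached from k >= 1.  Either part of the partition (X1, X2) may be
   empty. *)
Fixpoint perfectly_divisible (k : nat) (G : sgraph) {struct k} : Prop :=
  match k with
  | 0 => False
  | 1 => perfect G
  | k'.+1 =>
      forall X : {set G}, let H := induced X in
      stable [set: H] \/
      exists X1 X2 : {set H},
        [/\ X1 :|: X2 = [set: H], X1 :&: X2 = set0,
            omega (induced X1) < omega H
          & perfectly_divisible k' (induced X2)]
  end.

(* Main.v *)
Require Import Defs.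
From HB Require Import structures.
From mathcomp Require Import all_boot.

(** Fix a vertex [v] of an induced subgraph [K] of the given graph, and split
    [K] into the neighbourhood [N] of [v] and its complement [M].  A clique of
    [N] extends by [v], so [N] has smaller clique number.  Since [v] is isolated
    in [M], the graph [M - v] is [H]-free, hence perfectly [(k-1)]-divisible.
    If [H] has isolated vertices then [M] itself need not be [H]-free, but
    adding an isolated vertex preserves perfect divisibility: in a partition
    the isolated vertex can always join the part of smaller clique number,
    which matters only when that part is stable. *)

Set Implicit Arguments.
Unset Strict Implicit.
Unset Printing Implicit Defensive.

(** * Embeddings and induced subgraphs *)

Definition embedding (F G : sgraph) (f : F -> G) : Prop :=
  injective f /\ forall x y, adj (f x) (f y) = adj x y.

(** Being an induced subgraph up to isomorphism. Embeddings compose, so a subset of a subset need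
    not be flattened by hand when [induced] is nested. *)
Definition embeds (F G : sgraph) : Prop := exists f : F -> G, embedding f.

Lemma embeds_trans (F G K : sgraph) : embeds F G -> embeds G K -> embeds F K.
Proof.
move=> [f [fI fA]] [g [gI gA]]; exists (g \o f).
by split=> [|x y /=]; [exact: inj_comp | rewrite gA fA].
Qed.

Lemma embedding_val (F : sgraph) (X : {set F}) :
  embedding (val : induced X -> F).
Proof. by split=> //; exact: val_inj. Qed.

Lemma embeds_induced (G : sgraph) (X : {set G}) : embeds (induced X) G.
Proof. by exists val; exact: embedding_val. Qed.

Lemma embeds_into_induced (F G : sgraph) (f : F -> G) (X : {set G}) :
  embedding f -> (forall x, f x \in X) -> embeds F (induced X).
Proof.
move=> [fI fA] fX; exists (fun x => Sub (f x) (fX x) : induced X).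
split=> [x y /(congr1 val) /= /fI //|x y].
by rewrite /= /induced_adj /= fA.
Qed.

(** The bridge back to the official definitions, which quantify over vertex subsets only: an
    embedded graph is isomorphic to the induced subgraph on its image. *)
Lemma embedding_image (F G : sgraph) (f : F -> G) : embedding f ->
  exists (g : F -> induced (f @: F)) (h : induced (f @: F) -> F),
    [/\ cancel g h, cancel h g, embedding g & embedding h].
Proof.
move=> [fI fA]; have fX x : f x \in f @: F by exact: imset_f.
have preim (y : induced (f @: F)) : exists x, f x == val y.
  by case/imsetP: (valP y) => x _ ->; exists x.
pose g x : induced (f @: F) := Sub (f x) (fX x).
pose h y := xchoose (preim y).
have fh y : f (h y) = val y by apply/eqP; exact: (xchooseP (preim y)).
have gK : cancel g h by move=> x; apply: fI; rewrite fh.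
have hK : cancel h g by move=> y; apply: val_inj; rewrite /= fh.
exists g, h; split=> //; split; [exact: can_inj gK | | exact: can_inj hK |].
  by move=> x y; rewrite -fA.
by move=> x y; rewrite -fA !fh.
Qed.

Lemma freeP (F G : sgraph) : free F G <-> ~ embeds F G.
Proof.
split=> nFG.
- move=> [f fE]; apply: nFG; exists (f @: F).
  have [g [h [gK hK _ hE]]] := embedding_image fE.
  by exists h; split; [exists g | exact: (proj2 hE)].
- move=> [X [f [[g fK gK] fA]]]; apply: nFG.
  apply: embeds_trans (embeds_induced X); exists g.
  by split=> [|x y]; [exact: can_inj gK | rewrite -fA !gK].
Qed.

(** * Cliques, stable sets and colourings *)

Lemma cliqueP (G : sgraph) (A : {set G}) :
  reflect (forall x y, x \in A -> y \in A -> x != y -> adj x y) (clique A).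
Proof.
apply: (iffP forall_inP) => [cA x y xA yA|cA x xA].
  by move/forall_inP: (cA x xA) => /(_ y yA) /implyP.
by apply/forall_inP => y yA; apply/implyP; exact: cA.
Qed.

Lemma clique_embedding (F G : sgraph) (f : F -> G) (A : {set F}) :
  embedding f -> clique A -> clique (f @: A).
Proof.
move=> [fI fA] /cliqueP cA; apply/cliqueP => _ _ /imsetP[x xA ->] /imsetP[y yA ->] xy.
rewrite fA; apply: cA => //.
by apply: contraNneq xy => ->.
Qed.

Lemma clique_lift (G : sgraph) (X A : {set G}) : A \subset X -> clique A ->
  exists2 B : {set induced X}, clique B & A = val @: B.
Proof.
move=> /subsetP AX /cliqueP cA; exists [set x | val x \in A].
  by apply/cliqueP => x y; rewrite !inE; exact: cA.
apply/setP => x; apply/idP/imsetP => [xA|[y]]; last by rewrite inE => yA ->.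
by exists (Sub x (AX x xA)) => //; rewrite inE.
Qed.

Lemma clique_le_omega (G : sgraph) (A : {set G}) : clique A -> #|A| <= omega G.
Proof. by move=> cA; rewrite /omega (bigmax_sup A). Qed.

Lemma omega_leP (G : sgraph) (n : nat) :
  reflect (forall A : {set G}, clique A -> #|A| <= n) (omega G <= n).
Proof. exact: bigmax_leqP. Qed.

Lemma omega_embeds (F G : sgraph) : embeds F G -> omega F <= omega G.
Proof.
move=> [f fE]; apply/omega_leP => A cA.
rewrite -(card_imset (mem A) (proj1 fE)).
by apply: clique_le_omega; exact: clique_embedding.
Qed.

Lemma omega_induced_lt (G : sgraph) (X : {set G}) (n : nat) : 0 < n ->
  (forall A : {set G}, A \subset X -> clique A -> #|A| < n) ->
  omega (induced X) < n.
Proof.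
case: n => // n _ h; rewrite ltnS; apply/omega_leP => A cA.
rewrite -(card_imset (mem A) val_inj) -ltnS; apply: h.
  by apply/subsetP=> _ /imsetP[x _ ->]; exact: valP.
by apply: clique_embedding cA; exact: embedding_val.
Qed.

Lemma omega_gt0 (G : sgraph) : G -> 0 < omega G.
Proof.
move=> v; rewrite -(cards1 v); apply: clique_le_omega.
by apply/cliqueP => x y /set1P-> /set1P->; rewrite eqxx.
Qed.

Lemma omega_gt1 (G : sgraph) : ~~ stable [set: G] -> 1 < omega G.
Proof.
case/forall_inPn=> x _ /forall_inPn[y _]; rewrite negbK => xy.
have nxy : x != y by apply: contraTneq xy => ->; rewrite adj_irrefl.
have <- : #|[set x; y]| = 2 by rewrite cards2 nxy.
apply: clique_le_omega; apply/cliqueP => a b /set2P[]-> /set2P[]->;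
  by rewrite ?eqxx // adj_sym.
Qed.

Lemma stable_embeds (F G : sgraph) :
  embeds F G -> stable [set: G] -> stable [set: F].
Proof.
move=> [f [_ fA]] /forall_inP sG.
apply/forall_inP => x _; apply/forall_inP => y _; rewrite -fA.
by move/forall_inP: (sG (f x) (in_setT _)) => /(_ (f y) (in_setT _)).
Qed.

Lemma colorableP (G : sgraph) (n : nat) :
  reflect (exists c : G -> 'I_n, forall x y, adj x y -> c x != c y)
          (colorable G n).
Proof.
apply: (iffP existsP) => [[c cP]|[c cP]].
  exists c => x y; exact: implyP (forallP (forallP cP x) y).
exists (finfun c); apply/forallP => x; apply/forallP => y.
by apply/implyP; rewrite !ffunE; exact: cP.
Qed.

Lemma colorable_embeds (F G : sgraph) (n : nat) :
  embeds F G -> colorable G n -> colorable F n.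
Proof.
move=> [f [_ fA]] /colorableP[c cP]; apply/colorableP.
by exists (c \o f) => x y; rewrite -fA => /cP.
Qed.

(** A proper colouring is injective on a clique. Hence [chi] is never below [omega], and perfection
    is only a matter of colourability. *)
Lemma omega_le_colorable (G : sgraph) (n : nat) : colorable G n -> omega G <= n.
Proof.
move=> /colorableP[c cP]; apply/omega_leP => A /cliqueP cA.
rewrite -[n in _ <= n]card_ord -(@card_in_imset _ _ c (mem A)) ?max_card //.
move=> x y xA yA cxy; apply/eqP; apply: contraPT cxy => nxy.
by apply/eqP; exact/cP/cA.
Qed.

Lemma chi_eq_omega (G : sgraph) : chi G = omega G <-> colorable G (omega G).
Proof.
rewrite /chi; case: ex_minnP => m Gm minm; split=> [<- //|Go].
by apply/eqP; rewrite eqn_leq minm //= omega_le_colorable.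
Qed.

(** An embedded graph and its image embed in each other, so they have the same clique number and
    share colourings. *)
Lemma perfectP (G : sgraph) :
  perfect G <-> forall F, embeds F G -> colorable F (omega F).
Proof.
split=> [pG F [f fE]|h X]; last first.
  by apply/chi_eq_omega/h; exact: embeds_induced.
have [g [h [_ _ gE hE]]] := embedding_image fE.
have FX : embeds F (induced (f @: F)) by exists g.
have XF : embeds (induced (f @: F)) F by exists h.
have /eqP -> : omega F == omega (induced (f @: F)).
  by rewrite eqn_leq !omega_embeds.
by apply: (colorable_embeds FX); apply/chi_eq_omega.
Qed.

(** * Heredity of perfect divisibility *)

(** The condition that perfect divisibility puts on one induced subgraph. Abstracting [P] lets the
    induction on [k] enter as heredity of [P]. *)
Definition splits (P : sgraph -> Prop) (F : sgraph) : Prop :=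
  stable [set: F] \/
  exists X1 X2 : {set F},
    [/\ X1 :|: X2 = [set: F], X1 :&: X2 = set0,
        omega (induced X1) < omega F & P (induced X2)].

Lemma embeds_preim (F G : sgraph) (f : F -> G) (X : {set G}) :
  embedding f -> embeds (induced (f @^-1: X)) (induced X).
Proof.
move=> [fI fA].
have fE : embedding (f \o val : induced (f @^-1: X) -> G).
  by split=> [x y /= /fI /val_inj //|x y /=]; rewrite fA.
by apply: (embeds_into_induced fE) => x; have := valP x; rewrite inE.
Qed.

(** The partition is pulled back along the embedding of [F] in [G]. The opposite embedding keeps the
    inequality strict, since it bounds [omega G] by [omega F]. *)
Lemma splits_embeds (P : sgraph -> Prop) (F G : sgraph) :
  (forall K L, embeds K L -> P L -> P K) ->
  embeds F G -> embeds G F -> splits P G -> splits P F.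
Proof.
move=> hP FG GF [sG|[X1 [X2 [U I lt pX2]]]].
  by left; exact: stable_embeds sG.
case: FG => g gE; right; exists (g @^-1: X1), (g @^-1: X2); split.
- by rewrite -preimsetU U preimsetT.
- by rewrite -preimsetI I preimset0.
- apply: leq_ltn_trans (omega_embeds (embeds_preim X1 gE)) _.
  exact: leq_trans lt (omega_embeds GF).
- exact: hP (embeds_preim X2 gE) pX2.
Qed.

Lemma perfectly_divisible_embeds (k : nat) (F G : sgraph) :
  embeds F G -> perfectly_divisible k G -> perfectly_divisible k F.
Proof.
elim: k F G => [|[|k] IH] F G FG //.
  move=> /perfectP pG; apply/perfectP => K KF.
  by apply: pG; exact: embeds_trans FG.
move=> pG X.
have [f fE] := embeds_trans (embeds_induced X) FG.
have [g [h [_ _ gE hE]]] := embedding_image fE.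
apply: (splits_embeds IH _ _ (pG (f @: induced X))); first by exists g.
by exists h.
Qed.

Lemma perfectly_divisibleSP (k : nat) (G : sgraph) :
  perfectly_divisible k.+2 G <->
  forall F, embeds F G -> splits (perfectly_divisible k.+1) F.
Proof.
split=> [pG F FG|h X]; last by apply: h; exact: embeds_induced.
(* Heredity makes [F] itself divisible; its full vertex set then gives a splitting of a copy of
   [F]. *)
apply: (splits_embeds (@perfectly_divisible_embeds k.+1) _ _
         (perfectly_divisible_embeds FG pG [set: F])).
- by apply: (@embeds_into_induced _ _ id) => [|x]; [split | rewrite inE].
- exact: embeds_induced.
Qed.

(** * Adding an isolated vertex *)

Lemma perfectly_divisible_isolated (k : nat) (G : sgraph) (v : G) :
  (forall x, ~~ adj v x) ->
  perfectly_divisible k (induced [set~ v]) -> perfectly_divisible k G.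
Proof.
move=> iso.
have avoid (F : sgraph) (f : F -> G) :
    embedding f -> (forall x, f x != v) -> embeds F (induced [set~ v]).
  by move=> fE fv; apply: (embeds_into_induced fE) => x; rewrite !inE.
(* An induced subgraph either misses [v], or contains it as an isolated vertex [w] whose deletion
   leaves a subgraph of [G] minus [v]. *)
have hit (F : sgraph) (f : F -> G) : embedding f -> embeds F (induced [set~ v]) \/
    exists w : F, (forall x, ~~ adj w x)
      /\ embeds (induced [set~ w]) (induced [set~ v]).
  move=> fE; case: (pickP (fun x => f x == v)) => [w /eqP fw|fv].
    right; exists w; split=> [x|]; first by rewrite -(proj2 fE) fw.
    case: fE => fI fA; apply: (avoid _ (f \o val : induced [set~ w] -> G)).
      by split=> [x y /= /fI /val_inj //|x y /=]; rewrite fA.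
    move=> x /=; rewrite -fw (inj_eq fI).
    by have := valP x; rewrite !inE.
  by left; apply: avoid fE _ => x; rewrite fv.
case: k => [|[|k]] //.
- move/perfectP=> pG; apply/perfectP => F [f fE].
  case: (hit _ f fE) => [/pG //|[w [wiso /pG]]].
  have wF := omega_embeds (embeds_induced [set~ w]).
  move=> /colorableP[c cP]; apply/colorableP.
  (* The isolated vertex [w] receives colour 0, which cannot create a conflict. *)
  exists (fun x => match insub x : option (induced [set~ w]) with
                   | Some y => widen_ord wF (c y)
                   | None => Ordinal (omega_gt0 w)
                   end) => x y xy.
  have xw : x \in [set~ w].
    by rewrite !inE; apply: contraTneq xy => ->.
  have yw : y \in [set~ w].
    by rewrite !inE; apply: contraTneq xy => ->; rewrite adj_sym.
  by rewrite !insubT -val_eqE /= val_eqE; exact: cP.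
- move/perfectly_divisibleSP=> pG; apply/perfectly_divisibleSP => F [f fE].
  case: (hit _ f fE) => [/pG //|[w [wiso /pG]]].
  have wF := omega_embeds (embeds_induced [set~ w]).
  (* If [F] is not stable, its clique number is at least 2, which leaves room for the clique formed
     by [w] alone. *)
  have [sF|/omega_gt1 F2] := boolP (stable [set: F]); first by left.
  case=> [sw|[X1 [X2 [U I lt pX2]]]].
    have : stable [set: F].
      apply/forall_inP => x _; apply/forall_inP => y _.
      have [->|xw] := eqVneq x w; first exact: wiso.
      have [->|yw] := eqVneq y w; first by rewrite adj_sym wiso.
      have xw' : x \in [set~ w] by rewrite !inE.
      have yw' : y \in [set~ w] by rewrite !inE.
      move/forall_inP: sw => /(_ (Sub x xw') (in_setT _)) /forall_inP.
      by move=> /(_ (Sub y yw') (in_setT _)).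
    by left.
  pose f2 (x : induced X2) : F := val (val x).
  have f2E : embedding f2.
    by split=> [x y /val_inj /val_inj //|x y]; rewrite (embedding_val _).2.
  (* The complement of the copy of [X2] is the copy of [X1] together with [w]. *)
  right; exists (~: (f2 @: induced X2)), (f2 @: induced X2); split.
  + by rewrite setUC setUCr.
  + by rewrite setIC setICr.
  + apply: omega_induced_lt => [|A /subsetP AX cA]; first exact: ltnW.
    (* A clique through [w] is a singleton; any other one lifts through both levels of [induced] to
       a clique of [X1]. *)
    have [wA|wA] := boolP (w \in A).
      have -> : A = [set w]; last by rewrite cards1.
      apply/setP => x; rewrite inE; apply/idP/eqP => [xA|-> //].
      apply/eqP; apply: contraTT (wiso x) => xw; rewrite negbK.
      by move/cliqueP: cA => -> //; rewrite eq_sym.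
    have [|B cB AB] := @clique_lift _ [set~ w] A _ cA.
      by apply/subsetP => x xA; rewrite !inE; apply: contraNneq wA => <-.
    have [|C cC BC] := @clique_lift _ X1 B _ cB.
      apply/subsetP => x xB.
      have : x \in X1 :|: X2 by rewrite U inE.
      case/setUP=> // xX2.
      have /AX : val x \in A by rewrite AB; exact: imset_f.
      rewrite inE => /negP[].
      exact: (imset_f f2 (x := Sub x xX2 : induced X2)).
    rewrite AB BC !card_imset; try exact: val_inj.
    apply: leq_trans (leq_trans lt wF).
    by rewrite ltnS; exact: clique_le_omega.
  + have [g [h [_ _ gE hE]]] := embedding_image f2E.
    by apply: perfectly_divisible_embeds pX2; exists h.
Qed.

Theorem theorem2 (H : sgraph) (k : nat) (hk : 1 < k)
    (hH : forall G : sgraph, free H G -> perfectly_divisible (k - 1) G) :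
  forall G : sgraph, free (dunion H (complete 1)) G -> perfectly_divisible k G.
Proof.
case: k hk hH => [|[|k]] // _; rewrite subn1 /= => hH G /freeP nG.
apply/perfectly_divisibleSP => F FG.
(* Without a vertex to choose as [v], the graph is empty and so stable. *)
case: (pickP (fun x : F => true)) => [v _|F0]; last first.
  by left; apply/forall_inP => x; have := F0 x.
right; exists [set x | adj v x], (~: [set x | adj v x]).
split; [exact: setUCr | exact: setICr | |].
  apply: omega_induced_lt => [|A /subsetP AX /cliqueP cA].
    exact: omega_gt0 v.
  have vA : v \notin A by apply/negP => /AX; rewrite inE adj_irrefl.
  suff /clique_le_omega : clique (v |: A) by rewrite cardsU1 vA.
  apply/cliqueP => x y /setU1P[->|xA] /setU1P[->|yA]; rewrite ?eqxx //.
  - by have := AX y yA; rewrite inE.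
  - by have := AX x xA; rewrite inE adj_sym.
  - exact: cA.
have vM : v \in ~: [set x | adj v x] by rewrite !inE adj_irrefl.
pose v' : induced (~: [set x | adj v x]) := Sub v vM.
apply: (@perfectly_divisible_isolated _ _ v') => [x|].
  by have := valP x; rewrite !inE.
apply/hH/freeP => -[f [fI fA]]; apply/nG/(embeds_trans _ FG).
(* A copy of [H] in the non-neighbours of [v] other than [v], extended by [v] as the isolated
   vertex, would be a forbidden subgraph. *)
pose e (x : dunion H (complete 1)) : F :=
  if x is inl y then val (val (f y)) else v.
have fv y : (val (val (f y)) == v) = false.
  by have := valP (f y); rewrite !inE -val_eqE /= => /negbTE.
have nadj y : adj v (val (val (f y))) = false.
  by have := valP (val (f y)); rewrite !inE => /negbTE.
exists e; split.
- case=> [x|i] [y|j] //=.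
  + by move/val_inj/val_inj/fI->.
  + by move/eqP; rewrite fv.
  + by move/esym/eqP; rewrite fv.
  + by rewrite (ord1 i) (ord1 j).
- case=> [x|i] [y|j] /=.
  + exact: fA.
  + by rewrite adj_sym nadj.
  + by rewrite nadj.
  + by rewrite (ord1 i) (ord1 j) adj_irrefl.
Qed.
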